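(* Let $s\in\mathbb N$. The sum over all elements of an orbit of the action of the symmetric group $\Sigma_s$ (by leg-flips) on the top-degree generators of $HG_{1,s}$ represents a homology class in $H_{s-1}(HG_{1,s})$, and all classes arise in this manner. The top-degree homology classes in $HG_{1,s}$ form a partition of the set of holocolored graphs making up the one-loop $s$-point Green's function of a theory with cubic interaction and all masses different, that is, of the set of top-degree generators of $HG_{1,s}$.
   Context: A graph is admissible if it is connected, stays connected after removal of any single internal edge, and all its vertices have valence at least 3 (legs included). $\mathbb G_{1,s}$ is the set of admissible graphs with one independent loop and $s$ legs labeled by $1,\dots,s$. A holocolored graph is a pair $(G,c)$ with $G\in\mathbb G_{1,s}$ and $c:E_G\hookrightarrow\{1,\dots,s\}$ an injective coloring of the internal edges (colors stand for masses), considered up to isomorphism preserving leg labels and colors. $HG_{1,s}$ is the $\mathbb Z_2$-vector space spanned by holocolored graphs, graded by $|(G,c)|=|E_G|-1$, with differential $d(G,c)=\sum_{e\in E_G}(G/e,c|_{E_G\setminus\{e\}})$, where $G/e$ denotes contraction of $e$ and $G/e:=0$ if $e$ is a self-loop. Its top degree is $s-1$, so that $H_{s-1}(HG_{1,s})=\ker\big(d:(HG_{1,s})_{s-1}\to(HG_{1,s})_{s-2}\big)$. The generators of top degree are the cycle graphs with $s$ vertices, one labeled leg at each vertex, and $s$ edges bijectively colored by $\{1,\dots,s\}$; these are the graphs with all vertices three-valent. A leg-flip exchanges the labels of the legs at two neighboring vertices of such a cycle graph while keeping the color pattern of the edges fixed. Every permutation of the legs can be expressed as a sequence of leg-flips,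 which gives the action of $\Sigma_s$ on the set of top-degree generators; an orbit consists of all leg labelings of a cycle graph with a fixed edge color pattern.
   Formalization: For s=2 the only orbit sum is not a cycle, so sums over orbit elements are treated for s≠2 (for all s, sums over all s! leg labelings); ''all classes arise'' means orbit sums form a basis of the homology; the partition is by the supports of the orbit sums. *)

(* Defs.v *)
From HB Require Import structures.
From mathcomp Require Import all_boot all_order all_fingroup all_algebra.
From mathcomp Require Import generic_quotient.

Set Implicit Arguments.
Unset Strict Implicit.
Unset Printing Implicit Defensive.

Import GRing.Theory.
Local Open Scope ring_scope.
Local Open Scope quotient_scope.

(* Finite multigraphs with [s] labeled legs, whose vertices and internal edges
   are named by elements of [V] and [E].  The two ends of an edge are stored as
   an ordered pair; the order is forgotten by [iso_by] below.  The values of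
   [gends] outside [gedges] carry no information.  Leg labels are [0 .. s-1]. *)
Record graph (V E : finType) (s : nat) := Graph {
  gverts : {set V};
  gedges : {set E};
  gends : {ffun E -> V * V};
  glegs : {ffun 'I_s -> V}
}.

Section GraphFinite.
Variables (V E : finType) (s : nat).

Definition graph_code (G : graph V E s) :=
  (gverts G, gedges G, gends G, glegs G).
Definition graph_decode (u : {set V} * {set E} * {ffun E -> V * V} *
    {ffun 'I_s -> V}) : graph V E s :=
  let: (A, B, p, l) := u in Graph A B p l.
Lemma graph_codeK : cancel graph_code graph_decode.
Proof. by case. Qed.

HB.instance Definition _ := Finite.copy (graph V E s) (can_type graph_codeK).
End GraphFinite.

Section Admissible.
Variables (V E : finType) (s : nat).
Implicit Types (G : graph V E s) (e : E) (u v : V).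

Definition well_formed G :=
  [forall e in gedges G,
     ((gends G e).1 \in gverts G) && ((gends G e).2 \in gverts G)]
  && [forall i, glegs G i \in gverts G].

Definition self_loop G e := (gends G e).1 == (gends G e).2.

Definition adjacent G (F : {set E}) : rel V :=
  [rel u v | [exists e in F,
     (gends G e == (u, v)) || (gends G e == (v, u))]].

Definition connected G (F : {set E}) :=
  (gverts G != set0) &&
  [forall u in gverts G, forall v in gverts G, connect (adjacent G F) u v].

(* A self-loop contributes 2 to the valence of its vertex. *)
Definition valence G v : nat :=
  (#|[set e in gedges G | (gends G e).1 == v]|
   + #|[set e in gedges G | (gends G e).2 == v]|
   + #|[set i | glegs G i == v]|)%N.

Definition admissible G :=
  [&& well_formed G,
      connected G (gedges G),
      [forall e in gedges G, connected G (gedges G :\ e)]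
    & [forall v in gverts G, 3 <= valence G v]%N].

(* First Betti number of the graph: |E| - |V| + number of components. *)
Definition loop_number G : int :=
  #|gedges G|%:Z - #|gverts G|%:Z
  + (n_comp (adjacent G (gedges G)) (gverts G))%:Z.

(* The set G_{1,s}. *)
Definition one_loop_admissible G := admissible G && (loop_number G == 1).

(* For an edge [e = (u, v)] that is not a self-loop, the merged vertex of the
   contraction keeps the name [u]. *)
Definition merge G e (w : V) : V :=
  if w == (gends G e).2 then (gends G e).1 else w.

Definition contract G e : graph V E s :=
  Graph (gverts G :\ (gends G e).2)
        (gedges G :\ e)
        [ffun x => (merge G e (gends G x).1, merge G e (gends G x).2)]
        [ffun i => merge G e (glegs G i)].

End Admissible.

(* Pairs (G, c) with a map [c] from edges to colors [0 .. s-1]; the values of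
   [c] outside [gedges G] carry no information.  A graph in G_{1,s} with an
   injective coloring has |V| = |E| <= s, so ['I_s] has enough names for the
   vertices and for the edges of every holocolored graph, up to isomorphism. *)
Definition cgraph (s : nat) : finType :=
  (graph 'I_s 'I_s s * {ffun 'I_s -> 'I_s})%type.

Definition holocolored s (x : cgraph s) : bool :=
  one_loop_admissible x.1 && dinjectiveb x.2 (gedges x.1).

Definition swap_pair (T : Type) (p : T * T) : T * T := (p.2, p.1).

(* A bijection between two subsets of a finite type extends to a permutation of
   the type, so isomorphisms can be given by permutations of the names. *)
Definition iso_by s (f g : {perm 'I_s}) (x y : cgraph s) : bool :=
  [&& f @: gverts x.1 == gverts y.1,
      g @: gedges x.1 == gedges y.1,
      [forall e in gedges x.1,
         let p := (f (gends x.1 e).1, f (gends x.1 e).2) in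
         (gends y.1 (g e) == p) || (gends y.1 (g e) == swap_pair p)],
      [forall i, glegs y.1 i == f (glegs x.1 i)]
    & [forall e in gedges x.1, y.2 (g e) == x.2 e]].

Definition iso s : rel (cgraph s) :=
  fun x y => [exists f, exists g, iso_by f g x y].

Lemma isoP s (x y : cgraph s) :
  reflect (exists f g, iso_by f g x y) (iso x y).
Proof.
apply: (iffP existsP) => [[f /existsP[g h]]|[f [g h]]]; first by exists f, g.
by exists f; apply/existsP; exists g.
Qed.

Lemma iso_refl s : reflexive (@iso s).
Proof.
move=> x; apply/isoP; exists 1%g, 1%g.
have im1 (A : {set 'I_s}) : (1%g : {perm 'I_s}) @: A = A.
  by rewrite -[RHS]imset_id; apply: eq_imset => i; rewrite perm1.
rewrite /iso_by !im1 !eqxx /=; apply/and3P; split.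
- by apply/forall_inP => e _; rewrite !perm1 -surjective_pairing eqxx.
- by apply/forallP => i; rewrite perm1.
- by apply/forall_inP => e _; rewrite perm1.
Qed.

Lemma iso_trans s : transitive (@iso s).
Proof.
move=> y x z /isoP[f [g /and5P[/eqP fV /eqP gE /forall_inP ends /forallP legs
  /forall_inP col]]] /isoP[f' [g' /and5P[/eqP fV' /eqP gE' /forall_inP ends'
  /forallP legs' /forall_inP col']]].
have ing e : e \in gedges x.1 -> g e \in gedges y.1.
  by move=> h; rewrite -gE imset_f.
have imM (a b : {perm 'I_s}) (A : {set 'I_s}) : (a * b)%g @: A = b @: (a @: A).
  by rewrite -imset_comp; apply: eq_imset => i; rewrite permM.
apply/isoP; exists (f * f')%g, (g * g')%g.
rewrite /iso_by !imM fV gE fV' gE' !eqxx /=; apply/and3P; split.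
- apply/forall_inP => e he; rewrite !permM.
  have := ends' _ (ing _ he); rewrite /swap_pair /=.
  by case/orP: (ends _ he) => /eqP -> /= /orP[] /eqP ->; rewrite eqxx ?orbT.
- by apply/forallP => i; rewrite permM -(eqP (legs i)).
- by apply/forall_inP => e he; rewrite permM (eqP (col' _ (ing _ he))) col.
Qed.

Lemma iso_sym s : symmetric (@iso s).
Proof.
suff H : forall x y : cgraph s, iso x y -> iso y x.
  by move=> x y; apply/idP/idP; apply: H.
move=> x y /isoP[f [g /and5P[/eqP fV /eqP gE /forall_inP ends /forallP legs
  /forall_inP col]]].
have imV (a : {perm 'I_s}) (A : {set 'I_s}) : a^-1%g @: (a @: A) = A.
  rewrite -imset_comp -[RHS]imset_id.
  by apply: eq_imset => i /=; rewrite permK.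
apply/isoP; exists f^-1%g, g^-1%g.
rewrite /iso_by -fV -gE !imV !eqxx /=; apply/and3P; split.
- apply/forall_inP => _ /imsetP[e he ->]; rewrite permK.
  by case/orP: (ends _ he) => /eqP ->; rewrite /swap_pair /= !permK
     -surjective_pairing eqxx ?orbT.
- by apply/forallP => i; rewrite (eqP (legs i)) permK.
- by apply/forall_inP => _ /imsetP[e he ->]; rewrite permK eq_sym col.
Qed.

Canonical iso_equiv s : equiv_rel (cgraph s) :=
  EquivRel (@iso s) (@iso_refl s) (@iso_sym s) (@iso_trans s).

Definition iso_class (s : nat) : Type := {eq_quot (@iso s)}.
HB.instance Definition _ s := Choice.on (iso_class s).
HB.instance Definition _ s := EqQuotient.on (iso_class s).
Definition iso_class_reprK s :
  cancel (repr : iso_class s -> cgraph s) \pi_(iso_class s) := @reprK _ _.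
HB.instance Definition _ s := CanIsCountable (@iso_class_reprK s).
HB.instance Definition _ s : isFinite (iso_class s) :=
  CanIsFinite (@iso_class_reprK s).

Lemma iso_classP s (x y : cgraph s) :
  reflect (\pi_(iso_class s) x = \pi_(iso_class s) y) (iso x y).
Proof. exact: eqquotP. Qed.

Lemma iso_repr s (x : cgraph s) : iso (repr (\pi_(iso_class s) x)) x.
Proof. by apply/iso_classP; rewrite reprK. Qed.

Definition degree s (x : cgraph s) : int := #|gedges x.1|%:Z - 1.

Definition generators s (k : int) : {set iso_class s} :=
  [set \pi_(iso_class s) x | x : cgraph s & holocolored x && (degree x == k)].

Definition chain (s : nat) := {ffun iso_class s -> ('F_2)^o}.
HB.instance Definition _ s := Vector.on (chain s).

Definition single s (q : iso_class s) : chain s := [ffun r => (r == q)%:R].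

(* The degree [k] part of the complex, as a subspace of the space spanned by
   all isomorphism classes of colored graphs. *)
Definition HG s (k : int) : {vspace chain s} :=
  <<[seq single q | q in generators s k]>>%VS.

Definition contractc s (x : cgraph s) (e : 'I_s) : cgraph s :=
  (contract x.1 e, x.2).

Definition diff_graph s (x : cgraph s) : chain s :=
  \sum_(e in gedges x.1 | ~~ self_loop x.1 e)
     single (\pi_(iso_class s) (contractc x e)).

Definition diff s (z : chain s) : chain s := \sum_q z q *: diff_graph (repr q).

Lemma contract_iso s (x y : cgraph s) (f g : {perm 'I_s}) (e : 'I_s) :
  well_formed x.1 -> iso_by f g x y -> e \in gedges x.1 -> ~~ self_loop x.1 e ->
  iso (contractc x e) (contractc y (g e)).
Proof.
case/andP=> /forall_inP wf _ /and5P[/eqP fV /eqP gE /forall_inP ends /forallP legs /forall_inP col] he nl.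
pose a := (gends x.1 e).1; pose b := (gends x.1 e).2.
have nab : a != b by [].
have imD (h : {perm 'I_s}) (A : {set 'I_s}) i : h @: (A :\ i) = (h @: A) :\ h i.
  apply/setP => j; apply/imsetP/setD1P => [[k /setD1P[ki kA] ->]|].
    by rewrite (inj_eq perm_inj) ki imset_f.
  by case=> jh /imsetP[k kA Ej]; exists k; rewrite ?in_setD1 ?kA ?andbT //;
     apply: contraNneq jh => <-; rewrite Ej.
have [f' [fV' fm]] : exists f' : {perm 'I_s},
    f' @: (gverts x.1 :\ b) = gverts y.1 :\ (gends y.1 (g e)).2 /\
    (forall w, merge y.1 (g e) (f w) = f' (merge x.1 e w)).
  case/orP: (ends _ he) => /eqP; rewrite -/a -/b => He; rewrite /merge He /=.
    exists f; split; first by rewrite imD fV.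
    by move=> w; rewrite (inj_eq perm_inj) -/a -/b; case: ifP.
  exists (f * tperm (f a) (f b))%g; split.
    rewrite imD permM tpermR -fV; congr (_ :\ _).
    have /andP[aV bV] := wf _ he.
    apply/eqP; rewrite eqEcard !card_imset; try exact: perm_inj.
    rewrite leqnn andbT.
    apply/subsetP => _ /imsetP[w wV ->]; rewrite permM.
    by case: tpermP => _; rewrite imset_f.
  move=> w; rewrite (inj_eq perm_inj) -/a -/b permM.
  have [->|nwa] := eqVneq w a; first by rewrite (negPf nab) tpermL.
  have [->|nwb] := eqVneq w b; first by rewrite tpermL.
  by rewrite tpermD // (inj_eq perm_inj) eq_sym.
apply/isoP; exists f', g; rewrite /iso_by /= fV' imD gE !eqxx /=.
apply/and3P; split.
- apply/forall_inP => k /setD1P[_ kE]; rewrite !ffunE /swap_pair /=.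
  by case/orP: (ends _ kE) => /eqP -> /=; rewrite !fm eqxx ?orbT.
- by apply/forallP => i; rewrite !ffunE (eqP (legs i)) fm.
- by apply/forall_inP => k /setD1P[_ kE]; apply: col.
Qed.

Lemma diff_graph_iso s (x y : cgraph s) :
  well_formed x.1 -> iso x y -> diff_graph x = diff_graph y.
Proof.
move=> wf /isoP[f [g h]]; have /and5P[/eqP fV /eqP gE /forall_inP ends _ _] := h.
have -> : diff_graph y = \sum_(e | (e \in gedges x.1) && ~~ self_loop x.1 e)
    single (\pi_(iso_class s) (contractc y (g e))).
  rewrite /diff_graph [LHS](reindex_inj (@perm_inj _ g)); apply: eq_bigl => e /=.
  rewrite -gE mem_imset; last exact: perm_inj.
  case eE: (e \in _) => //=; congr (~~ _); rewrite /self_loop.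
  have := ends _ eE; rewrite /swap_pair /=.
  by case/orP => /eqP -> /=; rewrite (inj_eq perm_inj) // eq_sym.
apply: eq_bigr => e /andP[eE nl]; congr single.
by apply/iso_classP; apply: (contract_iso wf h).
Qed.

(* The definition of [diff] does not depend on the chosen representatives. *)
Lemma diff_single s (x : cgraph s) :
  well_formed x.1 -> diff (single (\pi_(iso_class s) x)) = diff_graph x.
Proof.
move=> wf; rewrite /diff (bigD1 (\pi_(iso_class s) x)) //= ffunE eqxx scale1r.
rewrite big1 ?addr0 => [|q nq]; last by rewrite ffunE (negPf nq) scale0r.
by apply/esym/(diff_graph_iso wf); rewrite iso_sym iso_repr.
Qed.

Lemma diff_is_linear s : linear (@diff s).
Proof.
move=> a z1 z2; rewrite /diff scaler_sumr -big_split /=.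
by apply: eq_bigr => q _; rewrite !ffunE scalerDl scalerA.
Qed.
HB.instance Definition _ s :=
  GRing.isLinear.Build _ (chain s) (chain s) _ (@diff s) (@diff_is_linear s).

Definition top_degree (s : nat) : int := s%:Z - 1.

Definition top_generators s : {set iso_class s} := generators s (top_degree s).

(* There is nothing in degree [s], so the top homology is the kernel. *)
Definition top_homology s : {vspace chain s} :=
  (lker (linfun (@diff s)) :&: HG s (top_degree s))%VS.

(* The permutation [sigma] moves the label [i] to the leg labeled [sigma i]:
   the leg that carried [i] now carries [sigma i]. *)
Definition relabel s (x : cgraph s) (sigma : {perm 'I_s}) : cgraph s :=
  (Graph (gverts x.1) (gedges x.1) (gends x.1)
     [ffun i => glegs x.1 (sigma^-1%g i)], x.2).

Lemma relabel_iso s (x y : cgraph s) (sigma : {perm 'I_s}) :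
  iso x y -> iso (relabel x sigma) (relabel y sigma).
Proof.
case/isoP=> f [g /and5P[hV hE hp /forallP hl hc]]; apply/isoP; exists f, g.
apply/and5P; split=> //; apply/forallP => i /=.
by rewrite !ffunE (eqP (hl _)).
Qed.

Definition relabel_class s (q : iso_class s) (sigma : {perm 'I_s}) :
  iso_class s := \pi_(iso_class s) (relabel (repr q) sigma).

Lemma relabel_classE s (x : cgraph s) (sigma : {perm 'I_s}) :
  relabel_class (\pi_(iso_class s) x) sigma =
  \pi_(iso_class s) (relabel x sigma).
Proof. by apply/iso_classP/relabel_iso/iso_repr. Qed.

Lemma relabel_class1 s (q : iso_class s) : relabel_class q 1%g = q.
Proof.
rewrite -[RHS]reprK /relabel_class; congr (\pi_(iso_class s) _).
case: (repr q) => [[A B p l] c]; rewrite /relabel /=; congr (Graph _ _ _ _, _).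
by apply/ffunP => i; rewrite ffunE invg1 perm1.
Qed.

Lemma relabel_classM s (q : iso_class s) : act_morph (@relabel_class s) q.
Proof.
move=> a b; rewrite [relabel_class q a]/relabel_class relabel_classE.
congr (\pi_(iso_class s) (Graph _ _ _ _, _)).
by apply/ffunP => i; rewrite !ffunE invMg permM.
Qed.

(* The action of Sigma_s on isomorphism classes by relabeling the legs. *)
Definition leg_action s : {action {perm 'I_s} &-> iso_class s} :=
  TotalAction (@relabel_class1 s) (@relabel_classM s).

(* [r] arises from [q] by exchanging the labels [i] and [j] of two legs whose
   vertices are joined by an internal edge. *)
Definition leg_flip s : rel (iso_class s) :=
  fun q r => [exists i, exists j,
    adjacent (repr q).1 (gedges (repr q).1)
      (glegs (repr q).1 i) (glegs (repr q).1 j)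
    && (r == leg_action s q (tperm i j))].

(* The orbits of Sigma_s on the top-degree generators. *)
Definition leg_orbits s : {set {set iso_class s}} :=
  orbit (leg_action s) setT @: top_generators s.

Definition sum_over s (X : {set iso_class s}) : chain s :=
  \sum_(q in X) single q.

(* The sum over all s! leg labelings of [q].  It differs from the sum over the
   set of elements of the orbit of [q] when relabelings of [q] are isomorphic
   to each other. *)
Definition labeling_sum s (q : iso_class s) : chain s :=
  \sum_(sigma : {perm 'I_s}) single (leg_action s q sigma).

Definition chain_support s (z : chain s) : {set iso_class s} :=
  [set q | z q != 0].

(* The graphs of the one-loop s-point Green's function of a theory with cubic
   interaction and s distinct masses. *)
Definition cubic_generators s : {set iso_class s} :=
  [set \pi_(iso_class s) x | x : cgraph s &
     holocolored x && [forall v in gverts x.1, valence x.1 v == 3%N]].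

(* Main.v *)
Require Import Defs.
From mathcomp Require Import all_boot all_order all_fingroup all_algebra.
From mathcomp Require Import generic_quotient.
From mathcomp Require Import zify.

Set Implicit Arguments.
Unset Strict Implicit.
Unset Printing Implicit Defensive.

Import GRing.Theory.
Local Open Scope ring_scope.
Local Open Scope quotient_scope.

(* Contracting an edge [e] of a top-degree generator [x] creates one four-valent
   vertex, and the color of [e] is the only color missing from [x / e].  The two
   trivalent resolutions of that vertex compatible with a single loop are [x]
   and its leg-flip at [e], so the coefficient of [x / e] in [d z] is
   [z x + z (flip x)].  Hence a cycle is constant on the orbits generated by
   leg-flips, and conversely the sum over all leg labelings is a cycle because
   the labelings pair off under the flip at [e].  An automorphism fixes all the
   colored edges, so for [s <> 2] it is trivial, the action is free, and the
   sum over labelings is the sum over the orbit. *)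

(** * Counting valences, loops and incident edges in finite multigraphs *)

Lemma sum_card_fibers (A T : finType) (S : {set A}) (B : {set T}) (F : A -> T) :
  (forall x, x \in S -> F x \in B) ->
  (\sum_(v in B) #|[set x in S | F x == v]| = #|S|)%N.
Proof.
move=> FB; rewrite -sum1_card (partition_big F (mem B)) //=.
by apply: eq_bigr => v _; rewrite -sum1_card; apply: eq_bigl => x; rewrite inE.
Qed.

Section Incidence.
Variables (V E : finType) (s : nat).
Implicit Types (G : graph V E s) (e k : E) (u v w : V).

Definition incident G k v := ((gends G k).1 == v) || ((gends G k).2 == v).

Lemma adjacent_sym G (F : {set E}) : symmetric (adjacent G F).
Proof. by move=> u v; apply: eq_existsb => e; rewrite orbC. Qed.

Lemma sum_valence G : well_formed G ->
  (\sum_(v in gverts G) valence G v = 2 * #|gedges G| + s)%N.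
Proof.
case/andP=> /forall_inP wf /forallP wl; rewrite /valence !big_split /=.
rewrite !sum_card_fibers => [|e /wf /andP[]//|e /wf /andP[]//].
rewrite addnn -mul2n; congr addn.
rewrite -[RHS]card_ord -cardsT -(@sum_card_fibers _ _ _ (gverts G) (glegs G)) //.
by apply: eq_bigr => v _; apply: eq_card => i; rewrite !inE.
Qed.

(** Edges of a well-formed graph never leave [gverts G], so by connectedness [gverts G] is exactly
    the class of any one of its vertices. There is one component, and the Betti number is |E| - |V|
    + 1. *)
Lemma loop_numberE G : well_formed G -> connected G (gedges G) ->
  (loop_number G == 1) = (#|gedges G| == #|gverts G|).
Proof.
case/andP=> /forall_inP wf _ /andP[/set0Pn[u uV] /forall_inP cn].
rewrite /loop_number; suff -> : n_comp (adjacent G (gedges G)) (gverts G) = 1%N by lia.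
rewrite -(n_comp_connect (sym_connect_sym (adjacent_sym G (gedges G))) u).
apply: eq_n_comp_r => v; apply/idP/idP => [vV|/connectP[p]].
  by have /forall_inP := cn _ uV; apply.
elim: p u uV {cn} => [|w p IH] u uV /=; first by move=> _ ->.
case/andP=> /exists_inP[e /wf /andP[e1 e2] /orP[]/eqP ew] pw;
  by apply: IH pw; rewrite ew in e1 e2.
Qed.

(** The edge is the first step by which a path from [v] to [w] leaves [v]. Applied again after
    deleting that edge, the lemma yields a second edge at [v]. *)
Lemma connected_exit G (F : {set E}) v w :
  connected G F -> v \in gverts G -> w \in gverts G -> w != v ->
  exists2 k, k \in F & incident G k v && ~~ self_loop G k.
Proof.
case/andP=> _ /forall_inP cn vV wV wv; have /forall_inP/(_ _ wV) := cn _ vV.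
case/connectP=> p; elim: p => [|u p IH] /=; first by move=> _ wE; rewrite wE eqxx in wv.
have [->|uv] := eqVneq u v; first by case/andP=> _; apply: IH.
case/andP=> /exists_inP[k kF ek] _ _; exists k => //.
by case/orP: ek => /eqP ek; rewrite /incident /self_loop ek /= eqxx ?orbT //= eq_sym.
Qed.

(** Inclusion-exclusion: a self-loop at [v] is one incident edge but contributes two half-edges. *)
Lemma card_incident G v :
  (#|[set e in gedges G | (gends G e).1 == v]|
   + #|[set e in gedges G | (gends G e).2 == v]|
   = #|[set e in gedges G | incident G e v]|
     + #|[set e in gedges G | ((gends G e).1 == v) && ((gends G e).2 == v)]|)%N.
Proof.
rewrite -cardsUI; congr (_ + _)%N; apply: eq_card => e; rewrite !inE.
  by rewrite -andb_orr.
by rewrite andbACA andbb.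
Qed.

Lemma incident_contract G e k v : ~~ self_loop G e ->
  incident (contract G e) k v =
  if v == (gends G e).2 then false
  else if v == (gends G e).1 then
    incident G k (gends G e).1 || incident G k (gends G e).2
  else incident G k v.
Proof.
rewrite /self_loop /incident /= !ffunE /= /Defs.merge.
case: (gends G e) (gends G k) => a b [c d] /= ab.
have [->|vb] := eqVneq v b; last have [->|va] := eqVneq v a.
- have mb w : ((if w == b then a else w) == b) = false.
    by have [_|/negPf //] := eqVneq w b; apply: negPf.
  by rewrite !mb.
- by do 2 case: ifP => _; rewrite ?eqxx ?orbT ?orbF.
- have mv w : ((if w == b then a else w) == v) = (w == v).
    have [->|//] := eqVneq w b.
    by rewrite ![_ == v]eq_sym (negPf va) (negPf vb).
  by rewrite !mv.
Qed.

End Incidence.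

(** * Top-degree generators: cycles with two edges and one leg at each vertex *)

Section Top.
Variable s : nat.
Implicit Types (x y : cgraph s) (q r : iso_class s) (sigma : {perm 'I_s}).

Definition top x := holocolored x && (degree x == top_degree s).

(** Degree [s - 1] means [s] edges, and one loop means as many vertices as edges. Hence every name
    in ['I_s] occurs both as a vertex and as an edge. *)
Lemma top_card x : top x -> #|gedges x.1| = s /\ #|gverts x.1| = s.
Proof.
case/andP=> /andP[/andP[/and4P[wf cn _ _]]]; rewrite loop_numberE // => /eqP EV _.
by rewrite /degree /top_degree => D; split; lia.
Qed.

Lemma card_ord_setT (A : {set 'I_s}) : #|A| = s -> A = setT.
Proof. by move=> As; apply/eqP; rewrite eqEcard subsetT cardsT card_ord As leqnn. Qed.

Lemma top_edges x : top x -> gedges x.1 = setT.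
Proof. by case/top_card => /card_ord_setT. Qed.

Lemma top_verts x : top x -> gverts x.1 = setT.
Proof. by case/top_card => _ /card_ord_setT. Qed.

Lemma top_well_formed x : top x -> well_formed x.1.
Proof. by case/andP=> /andP[/andP[/and4P[]]]. Qed.

Lemma top_connected x : top x -> connected x.1 setT.
Proof. by move=> tx; rewrite -(top_edges tx); case/andP: tx => /andP[/andP[/and4P[]]]. Qed.

Lemma top_connected_minus x e : top x -> connected x.1 (setT :\ e).
Proof.
move=> tx; move: (top_edges tx); case/andP: tx => /andP[/andP[/and4P[_ _ /forall_inP h _]]] _ _ _ E.
by rewrite -E; apply: h; rewrite E.
Qed.

Lemma top_color_inj x : top x -> injective x.2.
Proof.
move=> tx; move: (top_edges tx); case/andP: tx => /andP[_ /dinjectiveP h] _ E i j.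
by apply: h; rewrite E.
Qed.

(** The valences sum to [2 * s + s] over [s] vertices and each is at least 3, so equality holds at
    every vertex. *)
Lemma top_valence x v : top x -> valence x.1 v = 3%N.
Proof.
move=> tx; have VT := top_verts tx; have [Es Vs] := top_card tx.
have vge w : (3 <= valence x.1 w)%N.
  by case/andP: tx => /andP[/andP[/and4P[_ _ _ /forall_inP h]]] _ _ _; apply: h; rewrite VT.
have := sum_valence (top_well_formed tx); rewrite Es => sumv.
have lei w : w \in gverts x.1 -> (3 <= valence x.1 w ?= iff (3 == valence x.1 w))%N.
  by split.
have [_] := leqif_sum lei; rewrite sumv sum_nat_const Vs.
have -> : (s * 3 == 2 * s + s)%N by lia.
move=> /esym/forall_inP/(_ v); rewrite VT => /(_ (in_setT v))/eqP <-.
by [].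
Qed.

Lemma ord_neq1 (v : 'I_s) : s != 1%N -> exists w, w != v.
Proof.
move=> s1; case: (pickP (predC1 v)) => [w|h]; first by exists w.
suff : (#|predC1 v| = 0)%N.
  by rewrite cardC1 card_ord; have := ltn_ord v; lia.
by apply: eq_card0.
Qed.

(** Some edge leaves [v] because another vertex exists; the graph without that edge is still
    connected, so a second one leaves [v]. *)
Lemma top_incident_ge2 x v : s != 1%N -> top x ->
  (1 < #|[set k | incident x.1 k v]|)%N.
Proof.
move=> s1 tx; have [w wv] := ord_neq1 v s1.
have VT u : u \in gverts x.1 by rewrite top_verts.
have [k _ /andP[kv _]] := connected_exit (top_connected tx) (VT v) (VT w) wv.
have [k' /setD1P[kk' _] /andP[k'v _]] :=
  connected_exit (top_connected_minus k tx) (VT v) (VT w) wv.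
by apply/card_gt1P; exists k', k; rewrite !inE.
Qed.

Lemma top_valenceE x v : top x ->
  (#|[set k | incident x.1 k v]|
   + #|[set k | ((gends x.1 k).1 == v) && ((gends x.1 k).2 == v)]|
   + #|[set i | glegs x.1 i == v]| = 3)%N.
Proof.
move=> tx; rewrite -(top_valence v tx) /valence card_incident top_edges //.
by congr (_ + _ + _)%N; apply: eq_card => k; rewrite !inE.
Qed.

(** Two of the three half-edges at a vertex belong to incident edges, which leaves room for at most
    one leg. As a self-map of ['I_s] the leg map is then bijective. *)
Lemma top_legs_inj x : top x -> injective (glegs x.1).
Proof.
move=> tx i j ij; have [s1|s1] := eqVneq s 1%N.
  by apply: ord_inj; have := ltn_ord i; have := ltn_ord j; lia.
have := top_valenceE (glegs x.1 j) tx; have := top_incident_ge2 (glegs x.1 j) s1 tx.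
move=> h1 h2; have /card_le1_eqP h : (#|[set i0 | glegs x.1 i0 == glegs x.1 j]| <= 1)%N by lia.
by apply: h; rewrite inE ?ij.
Qed.

Lemma top_leg_at x v : top x -> exists i, glegs x.1 i = v.
Proof.
move=> tx; have [g _ gK] := injF_bij (top_legs_inj tx).
by exists (g v); rewrite gK.
Qed.

Lemma top_card_incident x v : s != 1%N -> top x ->
  #|[set k | incident x.1 k v]| = 2%N.
Proof.
move=> s1 tx; have := top_valenceE v tx; have := top_incident_ge2 v s1 tx.
have [i iv] := top_leg_at v tx.
have : (0 < #|[set i | glegs x.1 i == v]|)%N by apply/card_gt0P; exists i; rewrite inE iv.
lia.
Qed.

Lemma top_no_loop x k : s != 1%N -> top x -> ~~ self_loop x.1 k.
Proof.
move=> s1 tx; set v := (gends x.1 k).1; apply/negP => /eqP kl.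
have := top_valenceE v tx; rewrite (top_card_incident v s1 tx).
have [i iv] := top_leg_at v tx.
have : (0 < #|[set i | glegs x.1 i == v]|)%N by apply/card_gt0P; exists i; rewrite inE iv.
have : (0 < #|[set k | ((gends x.1 k).1 == v) && ((gends x.1 k).2 == v)]|)%N.
  by apply/card_gt0P; exists k; rewrite inE -kl -/v eqxx.
lia.
Qed.

Lemma self_loop_neq1 x k : ~~ self_loop x.1 k -> s != 1%N.
Proof.
move=> nl; apply: contraNneq nl => s1; rewrite /self_loop; apply/eqP/ord_inj.
by have := ltn_ord (gends x.1 k).1; have := ltn_ord (gends x.1 k).2; lia.
Qed.

Lemma iso_by_incident x y f g k v : iso_by f g x y -> k \in gedges x.1 ->
  incident y.1 (g k) (f v) = incident x.1 k v.
Proof.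
case/and5P=> _ _ /forall_inP h _ _ /h /orP[]/eqP kE; rewrite /incident kE /=;
  by rewrite !(inj_eq perm_inj) // orbC.
Qed.

(** All names are in use, so the conditions on vertex and edge sets are automatic. An unordered pair
    of ends is determined by its incident vertices; testing [a], [b] and the preimages of [c], [d]
    recovers it. *)
Lemma incident_iso_by x y (f g : {perm 'I_s}) : top x -> top y ->
  (forall k v, incident y.1 (g k) (f v) = incident x.1 k v) ->
  (forall i, glegs y.1 i = f (glegs x.1 i)) ->
  (forall k, y.2 (g k) = x.2 k) -> iso_by f g x y.
Proof.
move=> tx ty hi hl hc; rewrite /iso_by !top_verts ?top_edges //.
have permT (h : {perm 'I_s}) : h @: setT = setT.
  by apply/eqP; rewrite eqEcard subsetT (card_imset _ (@perm_inj _ h)) leqnn.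
rewrite !permT !eqxx /=; apply/and3P; split.
- apply/forall_inP => k _; rewrite /swap_pair.
  have := hi k; rewrite /incident.
  case: (gends x.1 k) (gends y.1 (g k)) => a b [c d] /= h.
  have := h (f^-1%g d); have := h (f^-1%g c); have := h b; have := h a.
  rewrite !permKV !eqxx !orbT /= !xpair_eqE -![a == _](inj_eq (@perm_inj _ f)).
  rewrite -![b == _](inj_eq (@perm_inj _ f)) !permKV.
  rewrite ![f _ == c]eq_sym ![f _ == d]eq_sym.
  by do 4! case: (_ == _).
- by apply/forallP => i; rewrite hl.
- by apply/forall_inP => k _; rewrite hc.
Qed.
End Top.

(** * The fibers of edge contraction *)

Section Contraction.
Variable s : nat.
Implicit Types (x y : cgraph s) (q r : iso_class s) (sigma : {perm 'I_s}).

Lemma top_relabel x sigma : top (relabel x sigma) = top x.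
Proof.
suff vleg v : #|[set i | glegs (relabel x sigma).1 i == v]| = #|[set i | glegs x.1 i == v]|.
  have wfE : well_formed (relabel x sigma).1 = well_formed x.1.
    congr (_ && _); apply/forallP/forallP => h i; last by rewrite ffunE; apply: h.
    by have := h (sigma i); rewrite ffunE permK.
  rewrite /top /holocolored /one_loop_admissible /admissible wfE.
  congr ([&& _, _, _ & _] && _ && _ && _).
  by apply: eq_forallb => v; rewrite /valence vleg.
rewrite -[RHS](card_imset _ (@perm_inj _ sigma)); apply: eq_card => i; rewrite inE /= ffunE.
apply/idP/imsetP => [|[j]]; last by rewrite inE => jv ->; rewrite permK.
by exists (sigma^-1%g i); rewrite ?inE // permKV.
Qed.


Lemma other_edge x e v : s != 1%N -> top x -> incident x.1 e v ->
  exists2 k, k != e & forall j, j != e -> incident x.1 j v = (j == k).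
Proof.
move=> s1 tx ev; have := top_card_incident v s1 tx.
rewrite (cardsD1 e) inE ev => -[] /eqP/cards1P[k kE]; exists k => [|j je].
  by have := set11 k; rewrite -kE !inE => /andP[].
by have /setP/(_ j) := kE; rewrite !inE je.
Qed.

Lemma setD1_setT_inj (g : {perm 'I_s}) (e e' : 'I_s) :
  g @: (setT :\ e) = setT :\ e' -> g e = e'.
Proof.
move=> gE; apply/eqP; have /setP/(_ (g e)) := gE; rewrite !inE andbT.
rewrite mem_imset; last exact: perm_inj.
by rewrite !inE eqxx /= => /esym/negbFE.
Qed.

(* Splitting the four-valent vertex of [x / e] again gives back either [x] or
   its leg-flip: exchanging the two outer edges at the ends of [e] amounts to
   exchanging the two legs. *)
Lemma contract_fiber x y e e' i j : top x -> top y ->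
  ~~ self_loop x.1 e -> ~~ self_loop y.1 e' ->
  glegs x.1 i = (gends x.1 e).1 -> glegs x.1 j = (gends x.1 e).2 ->
  iso (contractc x e) (contractc y e') ->
  x.2 e = y.2 e' /\ (iso x y \/ iso (relabel x (tperm i j)) y).
Proof.
move=> tx ty nx ny; set a := (gends x.1 e).1; set b := (gends x.1 e).2.
set a' := (gends y.1 e').1; set b' := (gends y.1 e').2 => ia jb.
have ab : a != b by []. have ab' : a' != b' by [].
have s1 := self_loop_neq1 nx.
case/isoP=> f [g fg]; have /and5P[/= fV gE _ /forallP legs /forall_inP col] := fg.
rewrite !top_verts // in fV; rewrite !top_edges // in gE.
(* [f] and [g] permute all names, so matching the complements of single names forces the removed
   edges and the removed vertices to correspond. *)
have ge : g e = e' by apply/setD1_setT_inj/eqP.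
have fb : f b = b' by apply/setD1_setT_inj/eqP.
have {}col k : k != e -> y.2 (g k) = x.2 k.
  by move=> ke; apply/eqP/col; rewrite top_edges // !inE ke.
have {}legs k : Defs.merge y.1 e' (glegs y.1 k) = f (Defs.merge x.1 e (glegs x.1 k)).
  by have /eqP := legs k; rewrite !ffunE.
(* Both colorings are bijective and agree away from [e], so the one remaining color agrees as
   well. *)
have cole : y.2 (g e) = x.2 e.
  have [h _ hK] := injF_bij (top_color_inj ty).
  have [k kE] : exists k, y.2 (g k) = x.2 e by exists (g^-1%g (h (x.2 e))); rewrite permKV hK.
  have [ke|ke] := eqVneq k e; first by rewrite ke in kE.
  by move: kE; rewrite (col _ ke) => /(top_color_inj tx) ke'; move: ke; rewrite ke' eqxx.
split; first by rewrite -cole ge.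
(* In [x / e] the legs [i] and [j] both sit at [a]. If neither were at [b'] in [y], both would sit
   at [f a] there, against injectivity of the legs. *)
have fa : f a = a'.
  have := legs i; have := legs j; rewrite /Defs.merge ia jb -/a -/b -/a' -/b' eqxx (negPf ab).
  have [ib'|ib'] := eqVneq (glegs y.1 i) b'; first by move=> _ ->.
  have [jb'|jb'] := eqVneq (glegs y.1 j) b'; first by move=> ->.
  by move=> <- /(top_legs_inj ty) ij; move: ab; rewrite -ia -jb ij eqxx.
have ax : incident x.1 e a by rewrite /incident eqxx.
have bx : incident x.1 e b by rewrite /incident eqxx orbT.
have ay : incident y.1 e' a' by rewrite /incident eqxx.
have by' : incident y.1 e' b' by rewrite /incident eqxx orbT.
have [e1 e1n e1P] := other_edge s1 tx ax; have [e2 e2n e2P] := other_edge s1 tx bx.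
have [k1 k1n k1P] := other_edge s1 ty ay; have [k2 k2n k2P] := other_edge s1 ty by'.
have gne k : (g k == e') = (k == e) by rewrite -ge (inj_eq perm_inj).
have inc k v : k != e -> incident (contract y.1 e') (g k) (f v) = incident (contract x.1 e) k v.
  by move=> ke; rewrite (iso_by_incident v fg) //= top_edges // !inE ke.
have inc0 k v : v != a -> v != b -> incident y.1 (g k) (f v) = incident x.1 k v.
  move=> va vb; have [->|ke] := eqVneq k e.
    rewrite ge /incident -/a -/b -/a' -/b' -fa -fb !(inj_eq perm_inj).
    by rewrite ![_ == v]eq_sym.
  have := inc k v ke; rewrite !incident_contract // -/a -/b -/a' -/b' -fa -fb.
  by rewrite !(inj_eq perm_inj) (negPf va) (negPf vb).
have inca k : k != e -> (g k == k1) || (g k == k2) = (k == e1) || (k == e2).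
  move=> ke; have := inc k a ke; rewrite !incident_contract // -/a -/b -/a' -/b' fa.
  by rewrite eqxx (negPf ab) (negPf ab') eqxx e1P ?e2P ?k1P ?k2P ?gne.
have ky k : k != e -> incident y.1 (g k) a' = (g k == k1) by move=> ke; rewrite k1P ?gne.
have ky' k : k != e -> incident y.1 (g k) b' = (g k == k2) by move=> ke; rewrite k2P ?gne.
(* The contraction only shows that [g] maps the outer edges [e1], [e2] onto [k1], [k2] as a set:
   straight or crossed. For [s = 2] the two outer edges coincide. *)
have match_ends : (forall k, k != e -> (g k == k1) = (k == e1) /\ (g k == k2) = (k == e2)) \/
                  (forall k, k != e -> (g k == k1) = (k == e2) /\ (g k == k2) = (k == e1)).
  have g1 : exists2 k, k != e & g k = k1 by exists (g^-1%g k1); rewrite -?gne permKV.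
  have g2 : exists2 k, k != e & g k = k2 by exists (g^-1%g k2); rewrite -?gne permKV.
  case: g1 g2 => l1 l1n l1E [l2 l2n l2E]; rewrite -l1E -l2E in inca *.
  have := inca _ l1n; have := inca _ l2n; have := inca _ e1n; have := inca _ e2n.
  rewrite !(inj_eq perm_inj) ?eqxx ?orbT /=.
  move=> h3 h4 h1 h2.
  suff [[<- <-]|[<- <-]] : (l1 = e1 /\ l2 = e2) \/ (l1 = e2 /\ l2 = e1).
  - by left=> k _; rewrite !(inj_eq perm_inj).
  - by right=> k _; rewrite !(inj_eq perm_inj).
  move: h1 h2 h3 h4 => /esym/orP[] /eqP ? /esym/orP[] /eqP ? /orP[] /eqP ? /orP[] /eqP ?;
    subst; auto.
pose t := tperm a b.
have tv v : v != a -> v != b -> t v = v by move=> va vb; rewrite /t tpermD // eq_sym.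
have inca' v : incident x.1 e v = (v == a) || (v == b).
  by rewrite /incident -/a -/b ![_ == v]eq_sym.
have ince' v : incident y.1 (g e) (f v) = (v == a) || (v == b).
  by rewrite ge /incident -/a' -/b' -fa -fb !(inj_eq perm_inj) ![_ == v]eq_sym.
(* Exchanging the ends of [e] before applying [f] uncrosses the outer edges and preserves [e], so in
   both cases some vertex map respects all incidences. *)
have [phi [phiE phiI]] : exists phi : {perm 'I_s},
    (phi = f \/ phi = (t * f)%g) /\
    (forall k v, incident y.1 (g k) (phi v) = incident x.1 k v).
  case: match_ends => h; [exists f | exists (t * f)%g]; split; auto => k v.
    have [->|ke] := eqVneq k e; first by rewrite ince' inca'.
    have [h1 h2] := h k ke.
    have [->|va] := eqVneq v a; first by rewrite fa ky // e1P.
    have [->|vb] := eqVneq v b; first by rewrite fb ky' // e2P.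
    exact: inc0.
  rewrite permM; have [->|ke] := eqVneq k e.
    rewrite ince' inca'; case: (tpermP a b v) => [->|->|] //; by rewrite !eqxx orbT.
  have [h1 h2] := h k ke.
  have [->|va] := eqVneq v a; first by rewrite /t tpermL fb ky' // e1P.
  have [->|vb] := eqVneq v b; first by rewrite /t tpermR fa ky // e2P.
  by rewrite tv // inc0.
(* Independently of the edges, the two legs at the ends of [e] are straight or crossed. *)
have {}legs : (forall k, glegs y.1 k = f (glegs x.1 k)) \/
              (forall k, glegs y.1 k = f (t (glegs x.1 k))).
  have other k : k != i -> k != j -> glegs y.1 k = f (glegs x.1 k) /\ t (glegs x.1 k) = glegs x.1 k.
    move=> ki kj.
    have ka : glegs x.1 k != a by rewrite -ia (inj_eq (top_legs_inj tx)).
    have kb : glegs x.1 k != b by rewrite -jb (inj_eq (top_legs_inj tx)).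
    split; last exact: tv.
    have := legs k; rewrite /Defs.merge -/a -/b -/a' -/b' (negPf kb).
    by case: eqP => // _ /esym/eqP; rewrite -fa (inj_eq perm_inj) (negPf ka).
  have := legs i; have := legs j; rewrite /Defs.merge ia jb -/a -/b -/a' -/b' eqxx (negPf ab) fa.
  have yij : glegs y.1 i != glegs y.1 j.
    by rewrite (inj_eq (top_legs_inj ty)) -(inj_eq (top_legs_inj tx)) ia jb.
  case: eqVneq => [lj _|nj lj]; case: eqVneq => [li _|ni li]; first by rewrite li lj eqxx in yij.
  - left=> k; have [->|ki] := eqVneq k i; first by rewrite ia fa.
    have [->|kj] := eqVneq k j; first by rewrite jb fb.
    by case: (other k).
  - right=> k; have [->|ki] := eqVneq k i; first by rewrite ia /t tpermL fb.
    have [->|kj] := eqVneq k j; first by rewrite jb /t tpermR fa.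
    by case: (other k) => // -> ->.
  - by rewrite li lj eqxx in yij.
have {}col k : y.2 (g k) = x.2 k by have [->|] := eqVneq k e; [exact: cole | exact: col].
have tl k : t (glegs x.1 k) = glegs x.1 (tperm i j k) by rewrite inj_tperm ?ia ?jb //; apply: top_legs_inj tx.
have tt v : t (t v) = v by rewrite /t tpermK.
have tr : top (relabel x (tperm i j)) by rewrite top_relabel.
have isoL : (forall k, glegs y.1 k = phi (glegs x.1 k)) -> iso x y.
  by move=> hl; apply/isoP; exists phi, g; apply: incident_iso_by.
have isoR : (forall k, glegs y.1 k = phi (t (glegs x.1 k))) -> iso (relabel x (tperm i j)) y.
  move=> hl; apply/isoP; exists phi, g; apply: incident_iso_by => // k.
  by rewrite ffunE tpermV -tl.
(* Edges and legs both straight or both crossed give [x] itself; exactly one of them crossed gives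
   the flip. *)
case: phiE isoL isoR => -> isoL isoR; case: legs => hl; [left|right|right|left].
- exact: isoL.
- exact: isoR.
- by apply: isoR => k; rewrite permM tt.
- by apply: isoL => k; rewrite permM.
Qed.
End Contraction.

(** * Leg-flips and relabelings *)

Section LegAction.
Variable s : nat.
Implicit Types (x y : cgraph s) (q r : iso_class s) (sigma : {perm 'I_s}).

Lemma top_generatorsP q :
  reflect (exists2 x, top x & q = \pi_(iso_class s) x) (q \in top_generators s).
Proof. by apply: (iffP imsetP) => -[x]; rewrite ?inE; exists x; rewrite ?inE. Qed.

Lemma leg_actionE x sigma :
  leg_action s (\pi_(iso_class s) x) sigma = \pi_(iso_class s) (relabel x sigma).
Proof. exact: relabel_classE. Qed.

Lemma top_generators_acts : [acts setT, on top_generators s | leg_action s].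
Proof.
apply/actsP => sigma _ q.
suff h r tau : r \in top_generators s -> leg_action s r tau \in top_generators s.
  by apply/idP/idP => [/(h _ sigma^-1%g)|]; [rewrite actK | apply: h].
by case/top_generatorsP => x tx ->; apply/top_generatorsP; exists (relabel x tau);
  rewrite ?top_relabel ?leg_actionE.
Qed.

Lemma relabelM x sigma tau : relabel (relabel x sigma) tau = relabel x (sigma * tau)%g.
Proof.
by congr (Graph _ _ _ _, _); apply/ffunP => i; rewrite !ffunE invMg permM.
Qed.

Lemma relabel1 x : relabel x 1%g = x.
Proof.
case: x => [[A B p l] c]; congr (Graph _ _ _ _, _).
by apply/ffunP => i; rewrite ffunE invg1 perm1.
Qed.

(* Flipping at the vertices that carried the labels [i] and [j] in [x]. *)
Lemma relabel_flip x i j sigma :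
  relabel (relabel x sigma) (tperm (sigma i) (sigma j)) =
  relabel x (tperm i j * sigma)%g.
Proof. by rewrite relabelM -tpermJ conjgE mulKVg. Qed.

Definition at_ends x e i j :=
  glegs x.1 i = (gends x.1 e).1 /\ glegs x.1 j = (gends x.1 e).2.

Lemma at_ends_relabel x e i j sigma :
  at_ends x e i j -> at_ends (relabel x sigma) e (sigma i) (sigma j).
Proof. by case=> hi hj; split; rewrite /= ffunE permK. Qed.

Lemma top_at_ends x e : top x -> exists i j, at_ends x e i j.
Proof.
move=> tx; have [i hi] := top_leg_at (gends x.1 e).1 tx.
by have [j hj] := top_leg_at (gends x.1 e).2 tx; exists i, j.
Qed.

(** Conjugating along a path in the connected graph turns transpositions of neighboring legs into
    the transposition of the legs at its ends. The transpositions with one fixed label generate the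
    symmetric group. *)
Lemma flips_generate x (G : {group {perm 'I_s}}) : top x ->
  (forall e i j, at_ends x e i j -> tperm i j \in G) -> G :=: setT.
Proof.
move=> tx hG; apply/eqP; rewrite eqEsubset subsetT /=.
have trans i j k : tperm i j \in G -> tperm j k \in G -> tperm i k \in G.
  move=> ij jk; have [->|nik] := eqVneq i k; first by rewrite tperm1.
  have [<- //|njk] := eqVneq j k.
  by have := groupJ jk ij; rewrite tpermJ tpermR tpermD // eq_sym.
case: (pickP 'I_s) => [i _|no]; last first.
  apply/subsetP => g _; have -> : g = 1%g by apply/permP => i; have := no i.
  exact: group1.
rewrite -(gen_tperm i) gen_subG; apply/subsetP => _ /imsetP[j _ ->].
have /andP[_ /forall_inP cn] := top_connected tx.
have := cn (glegs x.1 i); rewrite top_verts // => /(_ (in_setT _))/forall_inP/(_ (glegs x.1 j) (in_setT _)).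
case/connectP=> p; elim: p i => [|u p IH] i /=.
  by move=> _ /(top_legs_inj tx) ->; rewrite tperm1.
case/andP=> /exists_inP[e _ eu]; have [k kE] := top_leg_at u tx; rewrite -kE in eu * => pk lk.
apply: (trans _ k); last exact: IH.
case/orP: eu => /eqP eu; first by apply: (hG e); rewrite /at_ends eu.
by rewrite tpermC; apply: (hG e); rewrite /at_ends eu.
Qed.

(** The permutations whose left multiplication preserves [P] form a group containing all flips,
    hence everything. Left multiplication by [tperm i j] is the flip at [e] in the already relabeled
    graph. *)
Lemma flip_ind x (P : pred {perm 'I_s}) : top x -> P 1%g ->
  (forall e i j sigma, at_ends x e i j -> P sigma -> P (tperm i j * sigma)%g) ->
  forall sigma, P sigma.
Proof.
move=> tx P1 PS sigma; pose A := [set g : {perm 'I_s} | [forall tau, P tau ==> P (g * tau)%g]].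
have gA : group_set A.
  apply/group_setP; split=> [|g h]; rewrite !inE.
    by apply/forall_inP => tau; rewrite mul1g.
  move=> /forall_inP hg /forall_inP hh; apply/forall_inP => tau Pt.
  by rewrite -mulgA; apply: hg; apply: hh.
have AT : A = setT.
  apply: (@flips_generate x (Group gA) tx) => e i j he; rewrite inE.
  by apply/forall_inP => tau; apply: PS he.
by have := in_setT sigma; rewrite -AT inE => /forall_inP/(_ _ P1); rewrite mulg1.
Qed.

(** [leg_flip] inspects the chosen representative of the class; the isomorphism from [x] to it
    carries [e] to an edge joining the vertices of the same two legs. *)
Lemma leg_flip_at_ends x e i j : top x -> at_ends x e i j ->
  leg_flip (\pi_(iso_class s) x) (\pi_(iso_class s) (relabel x (tperm i j))).
Proof.
move=> tx [hi hj]; apply/existsP; exists i; apply/existsP; exists j.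
rewrite leg_actionE eqxx andbT; have := iso_repr x; rewrite iso_sym.
case/isoP=> f [g /and5P[_ /eqP gE /forall_inP h /forallP hl _]].
have eE : e \in gedges x.1 by rewrite (top_edges tx) in_setT.
apply/exists_inP; exists (g e); first by rewrite -gE imset_f.
by rewrite !(eqP (hl _)) hi hj; apply: h.
Qed.

Lemma leg_flip_orbit q : q \in top_generators s ->
  orbit (leg_action s) setT q = [set r | connect (@leg_flip s) q r].
Proof.
case/top_generatorsP => x tx ->; apply/setP => r; rewrite inE; apply/orbitP/idP.
  case=> sigma _ <-; rewrite leg_actionE.
  apply: (flip_ind (P := fun tau => connect (@leg_flip s) (\pi_(iso_class s) x)
    (\pi_(iso_class s) (relabel x tau))) tx) sigma => [|e i j tau he /connect_trans].
    by rewrite relabel1.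
  apply; rewrite -relabel_flip; apply/connect1/(leg_flip_at_ends (e := e)).
    by rewrite top_relabel.
  exact: at_ends_relabel.
case/connectP=> p; elim: p (\pi_(iso_class s) x) => [|u p IH] q0 /=.
  by move=> _ ->; exists 1%g; [rewrite inE | exact: relabel_class1].
case/andP=> /existsP[i /existsP[j /andP[_ /eqP ->]]] /IH{}IH /IH[sigma _ <-].
by exists (tperm i j * sigma)%g; [rewrite inE | exact: relabel_classM].
Qed.

(* The two edges at a vertex moved by an automorphism would both have to be
   reversed, hence join the same two vertices. *)
Lemma top_relabel_iso x sigma : s != 2%N -> top x ->
  iso x (relabel x sigma) -> sigma = 1%g.
Proof.
move=> s2 tx /isoP[f [g fg]]; have /and5P[_ _ _ /forallP hl hc] := fg.
have g1 k : g k = k.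
  by apply: (top_color_inj tx); apply/eqP/(forall_inP hc); rewrite top_edges.
have inc k v : incident x.1 k (f v) = incident x.1 k v.
  by rewrite -(iso_by_incident v fg) ?top_edges // g1.
suff f1 v : f v = v.
  apply/permP => i; rewrite perm1; apply: (top_legs_inj tx).
  by have /eqP := hl (sigma i); rewrite /= ffunE permK f1.
have [s1|s1] := eqVneq s 1%N.
  by apply: ord_inj; have := ltn_ord (f v); have := ltn_ord v; lia.
apply/eqP/negPn/negP => fv; case/negP: s2.
(* Every edge at [v] is also incident to [f v], so [S] is closed under adjacency. Connectedness
   makes [S] the whole vertex set, which gives [s = 2]. *)
pose S := [set v; f v].
have incS k : incident x.1 k v -> forall w, incident x.1 k w = (w \in S).
  move=> kv w; have kfv : incident x.1 k (f v) by rewrite inc.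
  move: kv kfv; rewrite /incident !inE; case: (gends x.1 k) => a b /=.
  case/orP=> /eqP vE; rewrite -vE in fv * => /orP[]/eqP h.
  - by rewrite -h eqxx in fv.
  - by rewrite -h [w == a]eq_sym [w == b]eq_sym.
  - by rewrite -h [w == a]eq_sym [w == b]eq_sym orbC.
  - by rewrite -h eqxx in fv.
have incS' k w : w \in S -> incident x.1 k w -> incident x.1 k v.
  by rewrite !inE => /orP[]/eqP ->; rewrite ?inc.
have ST : S = setT.
  apply/setP => w; rewrite [RHS]inE.
  have /andP[_ /forall_inP cn] := top_connected tx.
  have := cn v; rewrite top_verts // => /(_ (in_setT _))/forall_inP/(_ w (in_setT _)).
  have vS : v \in S by rewrite !inE eqxx.
  case/connectP=> p; elim: p (v) vS => [|u p IH] t tS /=; first by move=> _ ->.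
  case/andP=> /exists_inP[k _ ku]; apply: IH.
  have kv : incident x.1 k v.
    by apply: (incS' k t) => //; case/orP: ku => /eqP ku; rewrite /incident ku /= eqxx ?orbT.
  by rewrite -(incS k kv); case/orP: ku => /eqP ku; rewrite /incident ku /= eqxx ?orbT.
by rewrite -[s in s == _]card_ord -cardsT -ST cards2 [v == _]eq_sym fv.
Qed.

End LegAction.

(** * Cycles of top degree *)

Section Homology.
Variable s : nat.
Implicit Types (x y : cgraph s) (q r : iso_class s) (sigma : {perm 'I_s}).
Implicit Types (z : chain s) (X : {set iso_class s}).

Lemma F2_addrr (a : 'F_2) : a + a = 0.
Proof. by rewrite -mulr2n -mulr_natr pchar_Fp_0 ?mulr0. Qed.

Lemma chain_addrr z : z + z = 0.
Proof. by apply/ffunP => q; rewrite !ffunE F2_addrr. Qed.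

Lemma single_top q : q \in top_generators s -> single q \in HG s (top_degree s).
Proof. by move=> qT; apply: memv_span; apply: map_f; rewrite mem_enum. Qed.

Lemma span_vanish (S : seq (chain s)) z q :
  (forall w : chain s, w \in S -> w q = 0) -> z \in <<S>>%VS -> z q = 0.
Proof.
move=> Sq zS; rewrite (coord_span (X := in_tuple _) zS) sum_ffunE big1 // => i _.
by rewrite ffunE Sq ?scaler0 //; apply: mem_nth.
Qed.

Lemma HG_support z q : z \in HG s (top_degree s) -> z q != 0 -> q \in top_generators s.
Proof.
move=> zH; apply: contraNT => qT; apply/eqP; apply: span_vanish zH => _ /mapP[r rT ->].
rewrite ffunE; case: eqVneq => // qr.
by rewrite mem_enum -qr (negPf qT) in rT.
Qed.

(** Left multiplication by [tperm i j] exchanges even and odd permutations, so the two halves of the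
    sum are equal and cancel modulo 2. *)
Lemma sum_tperm_invariant (F : {perm 'I_s} -> chain s) i j : i != j ->
  (forall sigma, F (tperm i j * sigma)%g = F sigma) -> \sum_sigma F sigma = 0.
Proof.
move=> ij FE; rewrite (bigID (fun sigma => odd_perm sigma)) /=.
suff -> : \sum_(sigma | odd_perm sigma) F sigma = \sum_(sigma | ~~ odd_perm sigma) F sigma.
  exact: chain_addrr.
rewrite (reindex_inj (mulgI (tperm i j))) /=; apply: eq_big => // sigma.
by rewrite odd_permM odd_tperm ij.
Qed.

(** The two legs at the ends of [e] meet at the merged vertex, so exchanging their labels is
    invisible: the contracted graphs are equal, not merely isomorphic. *)
Lemma contract_flip x e i j sigma : at_ends x e i j ->
  contractc (relabel x (tperm i j * sigma)%g) e = contractc (relabel x sigma) e.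
Proof.
case=> hi hj; congr (Graph _ _ _ _, _); apply/ffunP => k.
rewrite !ffunE invMg permM tpermV; case: tpermP => // ->;
  by rewrite /Defs.merge /= hi hj eqxx; case: eqP.
Qed.

Lemma diff_labeling_sum q : q \in top_generators s -> diff (labeling_sum q) = 0.
Proof.
case/top_generatorsP => x tx ->; rewrite /labeling_sum linear_sum /=.
(* Relabeling changes neither edges nor ends, so the set of contractible edges is independent of
   [sigma] and the two sums can be exchanged. *)
transitivity (\sum_sigma \sum_(e in gedges x.1 | ~~ self_loop x.1 e)
    single (\pi_(iso_class s) (contractc (relabel x sigma) e))).
  apply: eq_bigr => sigma _; rewrite relabel_classE diff_single //.
  by apply: top_well_formed; rewrite top_relabel.
rewrite exchange_big /= big1 // => e /andP[_ nl].
have [i [j ij]] := top_at_ends e tx.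
apply: (@sum_tperm_invariant _ i j) => [|sigma]; last by rewrite contract_flip.
by rewrite -(inj_eq (top_legs_inj tx)); case: ij => -> ->.
Qed.

Lemma labeling_sum_top q : q \in top_generators s -> labeling_sum q \in top_homology s.
Proof.
move=> qT; rewrite memv_cap memv_ker lfunE /= diff_labeling_sum // eqxx /=.
apply: memv_suml => sigma _; apply: single_top.
by rewrite (actsP (top_generators_acts s)) ?inE.
Qed.

(** By [contract_fiber], an edge of [y] contributes only if it has the color of [e], so at most one
    does, and then [y] is [x] or its flip. Conversely, both of these contract to [x / e]. *)
Lemma diff_single_contract x y e i j : top x -> top y -> ~~ self_loop x.1 e ->
  at_ends x e i j ->
  diff (single (\pi_(iso_class s) y)) (\pi_(iso_class s) (contractc x e)) =
  ((\pi_(iso_class s) y == \pi_(iso_class s) x)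
   || (\pi_(iso_class s) y == leg_action s (\pi_(iso_class s) x) (tperm i j)))%:R.
Proof.
move=> tx ty nx [hi hj]; have s1 := self_loop_neq1 nx.
rewrite leg_actionE diff_single ?top_well_formed // /diff_graph sum_ffunE.
under eq_bigr => k _ do rewrite ffunE.
have pi_iso u v : (\pi_(iso_class s) u == \pi_(iso_class s) v) = iso v u.
  by rewrite eq_sym; apply/eqP/idP => /iso_classP.
rewrite !pi_iso.
case: (pickP (fun k => iso (contractc x e) (contractc y k))) => [k xyk|no].
  have [ck xy] := contract_fiber tx ty nx (top_no_loop k s1 ty) hi hj xyk.
  have -> : iso x y || iso (relabel x (tperm i j)) y by apply/orP.
  rewrite (bigD1 k) /=; last by rewrite top_edges // inE top_no_loop.
  rewrite eq_sym pi_iso xyk big1 ?addr0 // => l /andP[_ lk].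
  rewrite eq_sym pi_iso; case xyl: (iso _ _) => //.
  have [cl _] := contract_fiber tx ty nx (top_no_loop l s1 ty) hi hj xyl.
  by move: lk; rewrite -(inj_eq (top_color_inj ty)) -ck cl eqxx.
rewrite big1 => [|k _]; last by rewrite eq_sym pi_iso no.
case: orP => // xy; exfalso.
suff [x' [tx' xy' cx]] : exists x', [/\ top x', iso x' y & contractc x' e = contractc x e].
  have nl' := top_no_loop e s1 tx'.
  have /isoP[f [g fg]] := xy'.
  have := no (g e); rewrite -cx (contract_iso (top_well_formed tx') fg) //.
  by rewrite (top_edges tx') inE.
case: xy => xy; [by exists x | exists (relabel x (tperm i j))]; split => //.
  by rewrite top_relabel.
by rewrite -[tperm i j]mulg1 contract_flip // relabel1.
Qed.

Lemma top_homologyP z :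
  reflect (diff z = 0 /\ z \in HG s (top_degree s)) (z \in top_homology s).
Proof. by rewrite memv_cap memv_ker lfunE; apply: (iffP andP) => -[/eqP]. Qed.

Lemma F2_nat (a : 'F_2) : a = (a != 0)%:R.
Proof. by case: a => -[|[|//]] h; apply: val_inj. Qed.

Lemma singleE q r : single q r = (r == q)%:R.
Proof. exact: ffunE. Qed.

Lemma chain_singles z : z = \sum_(q in chain_support z) single q.
Proof.
apply/ffunP => r; rewrite sum_ffunE [LHS]F2_nat big_mkcond (bigD1 r) //=.
rewrite big1 => [|q qr]; last by rewrite singleE eq_sym (negPf qr) if_same.
by rewrite inE singleE eqxx addr0; case: ifP.
Qed.

(** The left side is the coefficient of [x / e] in [diff z]; the conditional avoids counting [q]
    twice when the flip fixes its class. *)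
Lemma top_homology_flip z x e i j : z \in top_homology s -> top x ->
  ~~ self_loop x.1 e -> at_ends x e i j ->
  let q := \pi_(iso_class s) x in let r := leg_action s q (tperm i j) in
  z q + (if r == q then 0 else z r) = 0.
Proof.
move=> /top_homologyP[dz zH] tx nx hij q r.
have := congr1 (fun d : chain s => d (\pi_(iso_class s) (contractc x e))) dz.
rewrite {1}[z]chain_singles linear_sum sum_ffunE [RHS]ffunE => dz0; rewrite -[RHS]dz0.
transitivity (\sum_(p | (p == q) || (p == r)) z p).
  rewrite (bigD1 q) ?eqxx //=; congr (_ + _); case: ifP => rq.
    rewrite big_pred0 // => p; rewrite (eqP rq) orbb; exact: andbN.
  symmetry; apply: big_pred1 => p; rewrite [RHS]/=.
  have [->|pq] := eqVneq p q; first by rewrite andbF eq_sym rq.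
  by rewrite andbT.
rewrite big_mkcond [RHS]big_mkcond; apply: eq_bigr => p _; rewrite inE.
have [->|zp] := eqVneq (z p) 0; first by rewrite if_same.
have -> : z p = 1 by rewrite [LHS]F2_nat zp.
have /top_generatorsP[y ty ->] := HG_support zH zp.
rewrite (diff_single_contract tx ty nx hij) -/q -/r.
by case: (_ || _).
Qed.

Lemma F2_eq (a b : 'F_2) : a + b = 0 -> a = b.
Proof. by move=> ab; apply: (addIr b); rewrite ab F2_addrr. Qed.

Lemma top_homology_const z q sigma : z \in top_homology s ->
  q \in top_generators s -> z (leg_action s q sigma) = z q.
Proof.
move=> zH /top_generatorsP[x tx ->]; rewrite leg_actionE; apply/eqP.
apply: (flip_ind (P := fun tau => z (\pi_(iso_class s) (relabel x tau)) ==
  z (\pi_(iso_class s) x)) tx) sigma => [|e i j tau hij /eqP <-].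
  by rewrite relabel1.
rewrite -relabel_flip -leg_actionE; set y := relabel x tau; apply/eqP.
have hy := at_ends_relabel tau hij; rewrite -/y in hy.
have ty : top y by rewrite top_relabel.
have [nl|/negPn/eqP lp] := boolP (~~ self_loop y.1 e).
  have := top_homology_flip zH ty nl hy; cbv zeta; case: eqP => [->|_] // /F2_eq.
  by move=> ->.
(* At a self-loop both labels belong to the same vertex, so they coincide and the flip is the
   identity. *)
suff -> : tau i = tau j by rewrite tperm1 act1.
by apply: (top_legs_inj ty); case: hy => -> ->.
Qed.

End Homology.

(** * Orbit sums as a basis, the exceptional case [s = 2], and cubic graphs *)

Section Orbits.
Variable s : nat.
Implicit Types (x y : cgraph s) (q r : iso_class s) (sigma : {perm 'I_s}).
Implicit Types (z : chain s) (X : {set iso_class s}).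

Lemma labeling_sum_orbit q : s != 2%N -> q \in top_generators s ->
  labeling_sum q = sum_over (orbit (leg_action s) setT q).
Proof.
move=> s2 /top_generatorsP[x tx ->]; rewrite /sum_over /orbit big_imset /=.
  by apply: eq_bigl => sigma; rewrite inE.
move=> sigma tau _ _ st.
have {}st : leg_action s (\pi_(iso_class s) x) sigma = leg_action s (\pi_(iso_class s) x) tau := st.
apply/(mulIg tau^-1%g); rewrite mulgV.
apply: (top_relabel_iso s2 tx); apply/iso_classP.
by rewrite -leg_actionE actM st -actM mulgV act1.
Qed.

Lemma mem_leg_orbits X : X \in leg_orbits s ->
  exists2 q, q \in top_generators s & X = orbit (leg_action s) setT q.
Proof. by case/imsetP=> q; exists q. Qed.

Lemma leg_orbits_partition : partition (leg_orbits s) (top_generators s).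
Proof. exact/orbit_partition/top_generators_acts. Qed.

(** Constancy along orbits makes the support of a cycle a disjoint union of orbits, and a chain
    modulo 2 is determined by its support. *)
Lemma top_homology_sum_over z : z \in top_homology s ->
  z = \sum_(X in [set orbit (leg_action s) setT q | q in chain_support z]) sum_over X.
Proof.
move=> zH; have /top_homologyP[_ zG] := zH.
rewrite {1}[z]chain_singles; apply: set_partition_big.
apply/orbit_partition/actsP => sigma _ q.
suff h r tau : r \in chain_support z -> leg_action s r tau \in chain_support z.
  by apply/idP/idP => [/(h _ sigma^-1%g)|]; [rewrite actK | apply: h].
by rewrite !inE => zr; rewrite top_homology_const // (HG_support zG zr).
Qed.

Lemma sum_overE X q : sum_over X q = (q \in X)%:R.
Proof.
rewrite sum_ffunE big_mkcond (bigD1 q) //= big1 => [|r rq].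
  by rewrite singleE eqxx addr0; case: ifP.
by rewrite singleE eq_sym (negPf rq) if_same.
Qed.

Lemma chain_support_sum_over X : chain_support (sum_over X) = X.
Proof. by apply/setP => q; rewrite inE sum_overE; case: (q \in X). Qed.

(** At an element of [X] every indicator of another, disjoint block vanishes, so [sum_over X] is not
    in the span of the others. *)
Lemma free_sum_over (P : {set {set iso_class s}}) :
  trivIset P -> set0 \notin P -> free [seq sum_over X | X in P].
Proof.
move=> /trivIsetP tP P0; rewrite /image_mem.
have : {subset enum P <= P} by move=> X; rewrite mem_enum.
elim: (enum P) (enum_uniq P) => [|X L IH] /=; first by rewrite nil_free.
case/andP=> XL uL LP; rewrite free_cons IH ?andbT // => [|Y YL]; last first.
  by apply: LP; rewrite inE YL orbT.
have XP : X \in P by apply: LP; rewrite inE eqxx.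
have /set0Pn[q qX] : X != set0 by apply: contraNneq P0 => <-.
apply/negP => /span_vanish h; suff : sum_over X q = 0 by rewrite sum_overE qX.
apply: h => _ /mapP[Y YL ->]; rewrite sum_overE.
have XY : X != Y by apply: contraNneq XL => ->.
have YP : Y \in P by apply: LP; rewrite inE YL orbT.
by rewrite (disjointFr (tP _ _ XP YP XY) qX).
Qed.

(** With two vertices and no self-loops every edge joins both vertices, so exchanging the vertices
    fixes all edges and colors and realizes the flip as an isomorphism. *)
Lemma top_flip_two x i j : s = 2%N -> top x -> i != j ->
  leg_action s (\pi_(iso_class s) x) (tperm i j) = \pi_(iso_class s) x.
Proof.
move=> s2 tx ij; have s1 : s != 1%N by rewrite s2.
rewrite leg_actionE; apply/esym/iso_classP/isoP.
exists (tperm (glegs x.1 i) (glegs x.1 j)), 1%g.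
have all_inc k v : incident x.1 k v.
  have := top_no_loop k s1 tx; rewrite /self_loop /incident.
  case: (gends x.1 k) => a b /=; rewrite -!(inj_eq val_inj) /=.
  have := ltn_ord a; have := ltn_ord b; have := ltn_ord v; lia.
apply: incident_iso_by => // [|k v|k|k]; rewrite ?top_relabel ?perm1 //.
  by rewrite /incident /= -![_ || _]/(incident _ _ _) !all_inc.
by rewrite ffunE tpermV inj_tperm //; apply: top_legs_inj tx.
Qed.

(** The flip fixes each class, so the coefficient of [x / e] in [diff z] is that of [x] in [z]
    alone. Thus an orbit, here a single class, does not sum to a cycle, while a labeling sum has two
    equal terms and vanishes. *)
Lemma top_homology_two z : s = 2%N -> z \in top_homology s -> z = 0.
Proof.
move=> s2 zH; apply/ffunP => q; rewrite [RHS]ffunE.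
apply/eqP/negPn/negP => zq; case/negP: (zq); apply/eqP.
have /top_homologyP[_ zG] := zH; have /top_generatorsP[x tx qE] := HG_support zG zq.
have e : 'I_s by rewrite s2; exact: ord0.
have s1 : s != 1%N by rewrite s2.
have nl := top_no_loop e s1 tx; have [i [j ij]] := top_at_ends e tx.
have := top_homology_flip zH tx nl ij; cbv zeta.
rewrite top_flip_two // ?eqxx ?addr0 -?qE //.
by rewrite -(inj_eq (top_legs_inj tx)); case: ij => -> ->.
Qed.

Lemma top_homology_span :
  top_homology s = <<[seq labeling_sum q | q in top_generators s]>>%VS.
Proof.
apply/eqP; rewrite eqEsubv; apply/andP; split; last first.
  apply/span_subvP => _ /mapP[q qT ->].
  by apply: labeling_sum_top; rewrite mem_enum in qT.
apply/subvP => z zH; have [s2|s2] := eqVneq s 2%N.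
  by rewrite (top_homology_two s2 zH) mem0v.
rewrite (top_homology_sum_over zH); apply: memv_suml => X /imsetP[q].
rewrite inE => zq ->; have /top_homologyP[_ zG] := zH; have qT := HG_support zG zq.
rewrite -labeling_sum_orbit //; apply/memv_span/map_f.
by rewrite mem_enum.
Qed.

Lemma sum_over_top X : s != 2%N -> X \in leg_orbits s -> sum_over X \in top_homology s.
Proof.
by move=> s2 /mem_leg_orbits[q qT ->]; rewrite -labeling_sum_orbit // labeling_sum_top.
Qed.

Lemma top_homology_basis : s != 2%N ->
  basis_of (top_homology s) [seq sum_over X | X in leg_orbits s].
Proof.
move=> s2; apply/andP; split; last first.
  by have /and3P[_ tP P0] := leg_orbits_partition; apply: free_sum_over.
rewrite eqEsubv; apply/andP; split.
  by apply/span_subvP => _ /mapP[X XO ->]; apply: sum_over_top; rewrite // mem_enum in XO.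
apply/subvP => z zH; rewrite (top_homology_sum_over zH); apply: memv_suml => X.
case/imsetP=> q; rewrite inE => zq ->; apply/memv_span/map_f; rewrite mem_enum.
by have /top_homologyP[_ zG] := zH; apply/imset_f/(HG_support zG zq).
Qed.

(** One direction is [top_valence]. For the other, 3|V| = 2|E| + s and |E| = |V| give |E| = s, which
    is top degree. *)
Lemma top_cubic : top_generators s = cubic_generators s.
Proof.
apply/setP => q; apply/top_generatorsP/imsetP => -[x].
  move=> tx ->; exists x => //; rewrite inE; case/andP: (tx) => -> _ /=.
  by apply/forall_inP => v _; rewrite top_valence.
rewrite inE => /andP[hx /forall_inP h3] ->; exists x => //.
rewrite /top hx /degree /top_degree /=.
case/andP: (hx) => /andP[/and4P[wf cn _ _]]; rewrite loop_numberE // => /eqP EV _.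
have := sum_valence wf; rewrite (eq_bigr (fun=> 3)) => [|v /h3/eqP //].
rewrite sum_nat_const -EV => h; have -> : #|gedges x.1| = s by lia.
by [].
Qed.

Lemma cubic_partition :
  partition [set chain_support (sum_over X) | X in leg_orbits s] (cubic_generators s).
Proof.
rewrite -top_cubic (eq_imset (g := id)) ?imset_id; first exact: leg_orbits_partition.
exact: chain_support_sum_over.
Qed.

End Orbits.

Theorem mainTheorem3 (s : nat) :
  [/\ (* leg-flips generate the orbits of the symmetric group *)
      forall q, q \in top_generators s ->
        orbit (leg_action s) setT q = [set r | connect (@leg_flip s) q r],
      (* every s: sums over all leg labelings of a top-degree generator *)
      (forall q, q \in top_generators s ->
         labeling_sum q \in top_homology s) /\
      top_homology s = <<[seq labeling_sum q | q in top_generators s]>>%VS,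
      (* s <> 2: sums over the elements of an orbit *)
      s != 2%N ->
        (forall X, X \in leg_orbits s -> sum_over X \in top_homology s) /\
        basis_of (top_homology s) [seq sum_over X | X in leg_orbits s]
    & (* partition of the Green's function *)
      top_generators s = cubic_generators s /\
      partition [set chain_support (sum_over X) | X in leg_orbits s]
                (cubic_generators s)].
Proof.
split.
- exact: leg_flip_orbit.
- by split; [exact: labeling_sum_top | exact: top_homology_span].
- move=> s2; split; last exact: top_homology_basis.
  by move=> X; apply: sum_over_top.
- by split; [exact: top_cubic | exact: cubic_partition].
Qed.
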